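(* For any non-empty graph $G$, the orientation covering number $\sigma(G)$ is the smallest positive integer $k$ such that there are at least $\chi(G)$ maximal intersecting families over $[k]$, where $\chi(G)$ is the chromatic number of $G$ and $[k]=\{1,\dots,k\}$.
   Context: Graphs are finite, simple and undirected; a graph is non-empty if it has at least one vertex. An orientation of a graph $G$ assigns to every edge $xy\in E(G)$ exactly one of the two directions $(x,y)$ (oriented from $x$ to $y$, i.e. away from $x$) or $(y,x)$. Given a non-empty graph $G$ and $k$ orientations $\vec{G}_1,\dots,\vec{G}_k$ of $G$, we say that $\vec{G}_1,\dots,\vec{G}_k$ is an orientation covering of $G$ if whenever $x,y,z\in V(G)$ with $xy,xz\in E(G)$ ($y=z$ is allowed), there is some $i$ such that $(x,y),(x,z)\in E(\vec{G}_i)$, i.e. both edges are oriented away from $x$ in $\vec{G}_i$. The orientation covering number $\sigma(G)$ is the smallest positive integer $k$ such that there is a list of $k$ orientations of $G$ forming an orientation covering of $G$. For a positive integer $k$, let $\mathcal{P}([k])$ be the power set of $[k]$. A family $\mathcal{A}\subseteq\mathcal{P}([k])$ is intersecting if whenever $S,T\in\mathcal{A}$ (possibly $S=T$) then $S\cap T\neq\emptyset$. A family $\mathcal{A}\subseteq\mathcal{P}([k])$ is a maximal intersecting family over $[k]$ if $\mathcal{A}$ is intersecting and whenever $\mathcal{A}\subseteq\mathcal{B}\subseteq\mathcal{P}([k])$ and $\mathcal{B}$ is intersecting then $\mathcal{B}=\mathcal{A}$. *)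

(* Defs.v *)
From mathcomp Require Import all_boot.

Set Implicit Arguments.
Unset Strict Implicit.
Unset Printing Implicit Defensive.

Record sgraph := SGraph {
  vertex :> finType;
  adj : rel vertex;
  adj_sym : symmetric adj;
  adj_irrefl : irreflexive adj
}.

Definition proper_coloring (G : sgraph) (k : nat) (c : {ffun G -> 'I_k}) : bool :=
  [forall x, forall y, adj x y ==> (c x != c y)].

Definition colorable (G : sgraph) (k : nat) : bool :=
  [exists c : {ffun G -> 'I_k}, proper_coloring c].

Lemma colorable_ex (G : sgraph) : exists k, colorable G k.
Proof.
exists #|G|; apply/existsP; exists [ffun x => enum_rank x].
apply/forallP=> x; apply/forallP=> y; apply/implyP=> xy.
rewrite !ffunE (inj_eq enum_rank_inj).
by apply: contraTneq xy => ->; rewrite adj_irrefl.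
Qed.

Definition chromatic_number (G : sgraph) : nat := ex_minn (colorable_ex G).

(* An orientation is identified with its set of arcs. *)
Definition orientation (G : sgraph) (D : {set G * G}) : bool :=
  [forall x, forall y,
    if adj x y then ((x, y) \in D) (+) ((y, x) \in D) else (x, y) \notin D].

Definition orientation_covering (G : sgraph) (s : seq {set G * G}) : bool :=
  all (@orientation G) s &&
  [forall x, forall y, forall z, adj x y && adj x z ==>
    has (fun D : {set G * G} => ((x, y) \in D) && ((x, z) \in D)) s].

Definition coverable (G : sgraph) (k : nat) : bool :=
  [exists s : k.-tuple {set G * G}, orientation_covering s].

Lemma coverable_ex (G : sgraph) : exists k, (0 < k) && coverable G k.
Proof.
pose D (o : option G) : {set G * G} := [set p | adj p.1 p.2 &&
  ((Some p.1 == o) ||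
   (Some p.2 != o) && (enum_rank p.1 < enum_rank p.2))].
exists #|{: option G}|; rewrite {1}card_option /=.
apply/existsP; exists [tuple of map D (enum {: option G})].
apply/andP; split.
  apply/allP=> _ /mapP[o _ ->]; apply/forallP=> x; apply/forallP=> y.
  rewrite !inE /= [adj y x]adj_sym; case: ifPn => //= xy.
    have nxy : x != y by apply: contraTneq xy => ->; rewrite adj_irrefl.
    have nr : nat_of_ord (enum_rank x) != enum_rank y.
      by rewrite (inj_eq val_inj) (inj_eq enum_rank_inj).
    rewrite xy /=; case: (Some x =P o) => [<-|_] /=.
      by rewrite -[Some y == _]/(y == x) eq_sym (negPf nxy).
    by case: (Some y == o) => //=; case: ltngtP nr.
  by rewrite (negPf xy).
apply/forallP=> x; apply/forallP=> y; apply/forallP=> z.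
apply/implyP=> /andP[xy xz]; apply/hasP; exists (D (Some x)).
  by rewrite map_f ?mem_enum.
by rewrite !inE /= xy xz eqxx.
Qed.

Definition orientation_covering_number (G : sgraph) : nat :=
  ex_minn (coverable_ex G).

(* The ground set [k] is represented by 'I_k = {0, ..., k - 1}. *)
Definition intersecting (k : nat) (A : {set {set 'I_k}}) : bool :=
  [forall S in A, forall T in A, S :&: T != set0].

Definition maximal_intersecting (k : nat) (A : {set {set 'I_k}}) : bool :=
  maxset (@intersecting k) A.

Definition num_maximal_intersecting (k : nat) : nat :=
  #|[set A : {set {set 'I_k}} | maximal_intersecting A]|.

(* Main.v *)
(* A covering by k orientations assigns to each arc (x, y) the set S_xy of
   indices of the orientations that contain it.  For fixed x the sets S_xy form
   an intersecting family, while S_xy and S_yx are complementary; so extending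
   these families to maximal ones yields a proper colouring of G by maximal
   intersecting families.  Conversely, two distinct maximal intersecting
   families A and B contain some S in A with complement in B, so a proper
   colouring by maximal families provides such sets S_xy, and hence a
   covering. *)
Require Import Defs.
From mathcomp Require Import all_boot.

Lemma intersectingP (k : nat) (A : {set {set 'I_k}}) :
  reflect {in A &, forall S T, S :&: T != set0} (intersecting A).
Proof.
apply: (iffP forall_inP) => [AI S T SA TA | AI S SA].
  by move/forall_inP: (AI S SA); apply.
by apply/forall_inP => T TA; apply: AI.
Qed.

(** Adding [S] to [A] keeps the family intersecting, so maximality absorbs it; [S != set0] handles
    the pair of [S] with itself. *)
Lemma mem_maximal_intersecting (k : nat) (A : {set {set 'I_k}}) (S : {set 'I_k}) :
  maximal_intersecting A -> S != set0 ->
  {in A, forall T, S :&: T != set0} -> S \in A.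
Proof.
move=> /maxsetP[/intersectingP AI Amax] S0 SA.
rewrite -(Amax (S |: A)) ?setU11 ?subsetUr //.
apply/intersectingP => T U; rewrite !inE.
case/predU1P=> [->|TA] /predU1P[->|UA].
- by rewrite setIid.
- exact: SA.
- by rewrite setIC SA.
- exact: AI.
Qed.

(** Maximality of [A] rules out [A \subset B], so some [S] in [A] lies outside [B]. As [B] is
    maximal, [S] misses some [T] in [B]; then [~: S] contains [T], hence meets every member of [B]
    and belongs to it. *)
Lemma maximal_intersecting_separated (k : nat) (A B : {set {set 'I_k}}) :
  maximal_intersecting A -> maximal_intersecting B -> A != B ->
  exists2 S, S \in A & ~: S \in B.
Proof.
move=> Amax Bmax AB.
have [/intersectingP AI Aeq] := maxsetP Amax.
have [/intersectingP BI _] := maxsetP Bmax.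
have /subsetPn[S SA SB]: ~~ (A \subset B).
  apply: contra AB => sAB; apply/eqP/esym/Aeq => //.
  by apply/intersectingP.
have S0 : S != set0 by rewrite -(setIid S) AI.
have [T TB /eqP ST]: exists2 T, T \in B & S :&: T == set0.
  apply/exists_inP; apply: contraNT SB => /exists_inPn ST.
  exact: mem_maximal_intersecting.
have sTS : T \subset ~: S by rewrite -disjoints_subset -setI_eq0 setIC ST.
exists S => //; apply: mem_maximal_intersecting => // [|U UB].
  by apply: subset_neq0 sTS _; rewrite -(setIid T) BI.
by apply: subset_neq0 (setSI U sTS) _; apply: BI.
Qed.

Lemma colorable_card (G : sgraph) (T : finType) (A : {set T}) (f : G -> T) :
  (forall x, f x \in A) -> (forall x y, adj x y -> f x != f y) ->
  colorable G #|A|.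
Proof.
move=> fA fP; apply/existsP; exists [ffun x => enum_rank_in (fA x) (f x)].
apply/forallP=> x; apply/forallP=> y; apply/implyP=> xy; rewrite !ffunE.
apply: contra (fP x y xy) => /eqP/(congr1 enum_val).
by rewrite !enum_rankK_in // => ->.
Qed.

Lemma coverable_colorable (G : sgraph) (k : nat) :
  coverable G k -> colorable G (num_maximal_intersecting k).
Proof.
case/existsP=> s /andP[/allP sO /forallP sC].
pose S (x y : G) := [set i : 'I_k | (x, y) \in tnth s i].
pose F x := [set S x y | y in [pred y | adj x y]].
have FI x : intersecting (F x).
  apply/intersectingP => _ _ /imsetP[y xy ->] /imsetP[z xz ->].
  have /forallP/(_ z)/implyP := forallP (sC x) y.
  rewrite !inE in xy xz; rewrite xy xz => /(_ isT)/hasP[D /tnthP[i ->] Di].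
  by apply/set0Pn; exists i; rewrite !inE.
have Fmax x : exists A, maximal_intersecting A && (F x \subset A).
  by have [A Amax FA] := maxset_exists (FI x); exists A; apply/andP.
apply: (@colorable_card G _ _ (fun x => xchoose (Fmax x))) => [x | x y xy].
  by rewrite inE; case/andP: (xchooseP (Fmax x)).
have /andP[xmax /subsetP xF] := xchooseP (Fmax x).
have /andP[_ /subsetP yF] := xchooseP (Fmax y).
have Sx : S x y \in xchoose (Fmax x) by apply/xF/imset_f; rewrite inE.
have Sy : S y x \in xchoose (Fmax y) by apply/yF/imset_f; rewrite inE adj_sym.
(* With equal colours, [S x y] and [S y x] would share an index [i], and orientation [i] would
   contain both directions of the edge. *)
apply/eqP => xy_eq; rewrite -xy_eq in Sy.
have [/intersectingP xI _] := maxsetP xmax.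
have /set0Pn[i] := xI _ _ Sx Sy; rewrite !inE => /andP[xyi yxi].
have /forallP/(_ x)/forallP/(_ y) := sO _ (mem_tnth i s).
by rewrite xy xyi yxi.
Qed.

Lemma colorable_coverable (G : sgraph) (m k : nat) :
  colorable G m -> m <= num_maximal_intersecting k -> coverable G k.
Proof.
case/existsP=> c /forallP cP mk.
pose f x := enum_val (widen_ord mk (c x)).
have fmax x : maximal_intersecting (f x).
  by have := enum_valP (widen_ord mk (c x)); rewrite inE.
have f_neq x y : adj x y -> f x != f y.
  move=> xy; have := forallP (cP x) y; rewrite xy /=; apply: contra.
  by rewrite (inj_eq enum_val_inj) -val_eqE.
(* The default [set0] can arise only for non-adjacent pairs: adjacent vertices have distinct, hence
   separated, families. *)
pose S x y := odflt set0 [pick U in f x | ~: U \in f y].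
have SP x y : adj x y -> S x y \in f x /\ ~: S x y \in f y.
  move=> xy; rewrite /S; case: pickP => [U /andP[]//|noU].
  have [U Ux Uy] :=
    maximal_intersecting_separated _ _ _ (fmax x) (fmax y) (f_neq x y xy).
  by have := noU U; rewrite /= Ux Uy.
(* The vertex order breaks the tie between S x y and ~: S y x. *)
pose W x y := if enum_rank x < enum_rank y then S x y else ~: S y x.
have WP x y : adj x y -> W x y \in f x.
  move=> xy; rewrite /W; case: ifP => _; first by have [] := SP x y xy.
  by rewrite adj_sym in xy; have [] := SP y x xy.
have WC x y : adj x y -> W y x = ~: W x y.
  move=> xy; rewrite /W; case: ltngtP => [||/val_inj/enum_rank_inj yx] //.
    by rewrite setCK.
  by rewrite yx adj_irrefl in xy.
(* By [WC], each index [i] lies in exactly one of [W x y] and [W y x], so each [D i] is an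
   orientation. *)
pose D i := [set p : G * G | adj p.1 p.2 && (i \in W p.1 p.2)].
apply/existsP; exists [tuple D i | i < k]; apply/andP; split.
  apply/allP=> _ /mapP[i _ ->]; apply/forallP=> x; apply/forallP=> y.
  rewrite !inE /= (adj_sym y x); case: ifPn => [xy|/negPf-> //].
  by rewrite xy (WC x y xy) inE; case: (i \in W x y).
apply/forallP=> x; apply/forallP=> y; apply/forallP=> z.
apply/implyP=> /andP[xy xz].
(* [W x y] and [W x z] both lie in the intersecting family [f x]; a common index gives the
   orientation containing both arcs. *)
have [/intersectingP xI _] := maxsetP (fmax x).
have /set0Pn[i] := xI _ _ (WP _ _ xy) (WP _ _ xz).
rewrite inE => /andP[xyi xzi].
apply/hasP; exists (D i); first by rewrite map_f ?mem_enum.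
by rewrite !inE xy xz xyi xzi.
Qed.

Theorem theorem3 (G : sgraph) (hG : 0 < #|G|) :
  [/\ 0 < orientation_covering_number G,
      chromatic_number G
        <= num_maximal_intersecting (orientation_covering_number G)
    & forall k : nat, 0 < k -> chromatic_number G <= num_maximal_intersecting k ->
        orientation_covering_number G <= k].
Proof.
rewrite /orientation_covering_number /chromatic_number.
case: ex_minnP => s /andP[s_gt0 s_cov] s_min.
case: ex_minnP => m m_col m_min; split=> // [|k k_gt0 mk].
  exact/m_min/coverable_colorable.
by apply: s_min; rewrite k_gt0 (colorable_coverable _ _ _ m_col mk).
Qed.
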